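(* Let $m,n\ge 1$ be integers and let $R=[0,m]\times[0,n]$, where each of the $mn$ unit squares with integer corners contained in $R$ is assigned one of the two states occupied or vacant (arbitrarily). Then the following hold. (i) One of the events $LR^+(R,O)$ or $TD^*(R,V)$ always occurs, but not both. (ii) One of the events $LR^*(R,O)$ or $TD^+(R,V)$ always occurs, but not both.
   Context: Let $\{W_k\}$ be the closed axis-parallel unit squares with corners in $\mathbb{Z}^2$ tiling $\mathbb{R}^2$; $R=[0,m]\times[0,n]$ contains exactly $mn$ of them. Two distinct squares are *plus adjacent* if they share an edge and *star adjacent* if they share a corner (so plus adjacent squares are also star adjacent). A sequence of distinct squares $L=(J_1,\ldots,J_t)$ is a *plus connected left right crossing* of $R$ if: (a) every $J_i\in\{W_k\}$ is contained in $R$; (b) for $1\le i\le t-1$, $J_i$ is plus adjacent to $J_{i+1}$; (c) $J_1$ intersects the left edge of $R$ and no other $J_i$, $2\le i\le t$, intersects the left edge of $R$; (d) $J_t$ intersects the right edge of $R$ and no other $J_i$, $1\le i\le t-1$, intersects the right edge of $R$. A *plus connected top down crossing* is defined in the same way with the left and right edges of $R$ replaced by the top and bottom edges of $R$, respectively. *Star connected* left right and top down crossings are defined in the same way with ''plus adjacent'' replaced by ''star adjacent'' in (b). A crossing is occupied (vacant) if every square in it is occupied (vacant). $LR^+(R,O)$ (respectively $LR^*(R,O)$) is the event that $R$ contains an occupied plus connected (respectively star connected) left right crossing. $TD^+(R,V)$ (respectively $TD^*(R,V)$) is the event that $R$ contains a vacant plus connected (respectively star connected) top down crossing. *)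

(* Defs.v *)
(* MathComp / MathComp-Analysis. *)
From HB Require Import structures.
From mathcomp Require Import all_boot all_order all_algebra.
From mathcomp Require Import all_classical all_reals.
Set Implicit Arguments.
Unset Strict Implicit.
Unset Printing Implicit Defensive.
Import Order.TTheory GRing.Theory Num.Theory.
Local Open Scope classical_set_scope.
Local Open Scope ring_scope.

Definition box (R : realType) (a b c d : R) : set (R * R) :=
  `[a, b] `*` `[c, d].

Definition left_edge (R : realType) (a b c d : R) : set (R * R) :=
  [set a] `*` `[c, d].
Definition right_edge (R : realType) (a b c d : R) : set (R * R) :=
  [set b] `*` `[c, d].
Definition bottom_edge (R : realType) (a b c d : R) : set (R * R) :=
  `[a, b] `*` [set c].
Definition top_edge (R : realType) (a b c d : R) : set (R * R) :=
  `[a, b] `*` [set d].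

Definition box_edges (R : realType) (a b c d : R) : set (set (R * R)) :=
  [set left_edge a b c d; right_edge a b c d;
       bottom_edge a b c d; top_edge a b c d].

Definition box_corners (R : realType) (a b c d : R) : set (R * R) :=
  [set (a, c); (b, c); (a, d); (b, d)].

(* The unit squares tiling the plane are indexed by their lower left corner;
   distinct indices give distinct squares. *)
Definition site := (int * int)%type.

Definition square (R : realType) (k : site) : set (R * R) :=
  box k.1%:~R (k.1 + 1)%:~R k.2%:~R (k.2 + 1)%:~R.
Arguments square : clear implicits.

Definition square_edges (R : realType) (k : site) : set (set (R * R)) :=
  box_edges k.1%:~R (k.1 + 1)%:~R k.2%:~R (k.2 + 1)%:~R.
Arguments square_edges : clear implicits.

Definition square_corners (R : realType) (k : site) : set (R * R) :=
  box_corners k.1%:~R (k.1 + 1)%:~R k.2%:~R (k.2 + 1)%:~R.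
Arguments square_corners : clear implicits.

Definition plus_adjacent (R : realType) (k l : site) : Prop :=
  k <> l /\ square_edges R k `&` square_edges R l !=set0.

Definition star_adjacent (R : realType) (k l : site) : Prop :=
  k <> l /\ square_corners R k `&` square_corners R l !=set0.

(* A sequence (J_1, ..., J_t), t >= 1, is a [seq] indexed from 0, so that J_1
   has index 0 and J_t has index [(size L).-1]; the default value of [nth] is
   never reached. *)
Record crossing (R : realType) (adjacent : site -> site -> Prop)
    (rect start finish : set (R * R)) (L : seq site) : Prop := Crossing {
  crossing_nonempty : (0 < size L)%N;
  crossing_distinct : uniq L;
  crossing_inside : forall k, k \in L -> square R k `<=` rect;
  crossing_adjacent : forall i, (i.+1 < size L)%N ->
    adjacent (nth (0, 0) L i) (nth (0, 0) L i.+1);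
  crossing_first : square R (nth (0, 0) L 0) `&` start !=set0;
  crossing_first_only : forall i, (0 < i < size L)%N ->
    ~ (square R (nth (0, 0) L i) `&` start !=set0);
  crossing_last : square R (nth (0, 0) L (size L).-1) `&` finish !=set0;
  crossing_last_only : forall i, (i < (size L).-1)%N ->
    ~ (square R (nth (0, 0) L i) `&` finish !=set0) }.

Definition left_right_crossing (R : realType)
    (adjacent : site -> site -> Prop) (m n : nat) (L : seq site) : Prop :=
  crossing adjacent (box (0 : R) m%:R 0 n%:R)
    (left_edge 0 m%:R 0 n%:R) (right_edge 0 m%:R 0 n%:R) L.

Definition top_down_crossing (R : realType)
    (adjacent : site -> site -> Prop) (m n : nat) (L : seq site) : Prop :=
  crossing adjacent (box (0 : R) m%:R 0 n%:R)
    (top_edge 0 m%:R 0 n%:R) (bottom_edge 0 m%:R 0 n%:R) L.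

Inductive state : Set := Occupied | Vacant.

(* A configuration is given on all the squares of the plane; the events below
   only depend on its values on the squares contained in [0, m] x [0, n]. *)
Definition all_in_state (omega : site -> state) (s : state)
    (L : seq site) : Prop :=
  forall k, k \in L -> omega k = s.

Definition LR_plus (R : realType) (m n : nat) (omega : site -> state)
    (s : state) : Prop :=
  exists L, left_right_crossing R (plus_adjacent R) m n L
    /\ all_in_state omega s L.

Definition LR_star (R : realType) (m n : nat) (omega : site -> state)
    (s : state) : Prop :=
  exists L, left_right_crossing R (star_adjacent R) m n L
    /\ all_in_state omega s L.

Definition TD_plus (R : realType) (m n : nat) (omega : site -> state)
    (s : state) : Prop :=
  exists L, top_down_crossing R (plus_adjacent R) m n L
    /\ all_in_state omega s L.

Definition TD_star (R : realType) (m n : nat) (omega : site -> state)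
    (s : state) : Prop :=
  exists L, top_down_crossing R (star_adjacent R) m n L
    /\ all_in_state omega s L.

(* Main.v *)
Require Import Defs.
From HB Require Import structures.
From mathcomp Require Import all_boot all_order all_algebra.
From mathcomp Require Import all_classical all_reals.
From mathcomp Require Import zify.
Set Implicit Arguments.
Unset Strict Implicit.
Unset Printing Implicit Defensive.
Import Order.TTheory GRing.Theory Num.Theory.
Local Open Scope ring_scope.

(** A crossing can be cut out of any walk that joins the two edges of the
    rectangle: a shortest such walk repeats no square and meets each of the two
    edges only once ([linked_shortest]).  So the theorem is about walks in the
    two graphs [plus_adj] and [star_adj] on pairs of integers
    ([crossing_linked]), and both halves of (i) are parity arguments
    ([plus_star_dichotomy]).

    Both crossings cannot occur.  Fix the vacant star walk from bottom to top,
    prolonged by one square beyond each edge.  For a square c off that walk,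
    count modulo 2 the steps of the walk that pass between the row of c and the
    next row on the left of c ([walk_cut]).  The count does not change when c
    moves to a plus adjacent square off the walk ([walk_cut_step]): a star step
    cannot jump over the common edge of the two squares.  It is 0 when no square
    of the walk lies to the left of c, and 1 when they all do, because the walk
    then has to cross the level of c an odd number of times.  Hence a plus walk
    from left to right meets the star walk ([crossing_walks_meet]).

    One crossing occurs.  Let A be the set of squares joined to the left edge by
    occupied plus walks, together with the whole half plane left of the
    rectangle, and let B be the set of vacant squares joined to the bottom edge
    by vacant star walks.  If there is no occupied crossing, then in the rows of
    the rectangle every square outside A that is plus adjacent to A is a vacant
    square of the rectangle.  Consider the edges that separate a square of A from
    a square of B.  Around each lattice point strictly between the lines of the
    bottom and of the top edge, there is an even number of them, since the squares
    around the point that border A from outside are vacant and star adjacent to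
    each other, hence all in B or all outside B ([gate_vertex]).  Adding these
    relations along a horizontal line, where each horizontal edge is counted
    twice, shows that two consecutive rows contain the same number modulo 2 of
    such vertical edges.  In the bottom row all the vertical edges of the
    interface of A count, and there is an odd number of them because A holds at
    the left end and fails at the right end.  So there is one in the top row:
    B reaches the top ([interface_reaches_top]).

    Statement (ii) is (i) for the transposed rectangle, with the two states
    exchanged. *)

(** * Adjacency of squares and walks *)

Definition plus_adj (k l : site) : bool :=
  `|k.1 - l.1| + `|k.2 - l.2| == 1.
Definition star_adj (k l : site) : bool :=
  Num.max `|k.1 - l.1| `|k.2 - l.2| == 1.

Definition in_rect (m n : nat) (k : site) : bool :=
  (0 <= k.1 < m%:Z) && (0 <= k.2 < n%:Z).

Lemma plus_adj_sym : symmetric plus_adj.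
Proof. by move=> k l; rewrite /plus_adj; lia. Qed.

Lemma star_adj_sym : symmetric star_adj.
Proof. by move=> k l; rewrite /star_adj; lia. Qed.

Lemma in_rect_swap m n x y : in_rect m n (x, y) = in_rect n m (y, x).
Proof. exact: andbC. Qed.

Lemma plus_adj_cases (x y x' y' : int) : plus_adj (x, y) (x', y') ->
  [|| (x' == x + 1) && (y' == y), (x' == x) && (y' == y + 1),
      (x == x' + 1) && (y == y') | (x == x') && (y == y' + 1)].
Proof. by rewrite /plus_adj /=; lia. Qed.

Definition linked (T : eqType) (e : rel T) (P S F : pred T) : Prop :=
  exists x p, [/\ path e x p, all P (x :: p), S x & F (last x p)].

Lemma linked_refl (T : eqType) (e : rel T) (P S : pred T) x :
  P x -> S x -> linked e P S (pred1 x).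
Proof. by move=> Px Sx; exists x, [::]; split=> //=; rewrite ?Px ?eqxx. Qed.

Lemma linked_step (T : eqType) (e : rel T) (P S : pred T) x y :
  linked e P S (pred1 x) -> e x y -> P y -> linked e P S (pred1 y).
Proof.
move=> [s [p [sp Pp Ss /eqP lx]]] xy Py; exists s, (rcons p y); split=> //.
- by rewrite rcons_path sp lx.
- by rewrite -rcons_cons all_rcons Py.
- by rewrite last_rcons /= eqxx.
Qed.

Lemma linked_end (T : eqType) (e : rel T) (P S F : pred T) x :
  linked e P S (pred1 x) -> F x -> linked e P S F.
Proof. by move=> [s [p [sp Pp Ss /eqP <-]]] Fx; exists s, p. Qed.

Lemma linked_inside (T : eqType) (e : rel T) (P S : pred T) x :
  linked e P S (pred1 x) -> P x.
Proof. by move=> [s [p [_ /allP Pp _ /eqP <-]]]; exact/Pp/mem_last. Qed.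

Lemma linked_sym (T : eqType) (e : rel T) (P S F : pred T) :
  symmetric e -> linked e P S F -> linked e P F S.
Proof.
move=> e_sym [x [p [xp Pp Sx Fp]]].
exists (last x p), (rev (belast x p)); split=> //.
- by rewrite rev_path (eq_path (e' := e)) // => a b; rewrite e_sym.
- by rewrite -rev_rcons -lastI all_rev.
- suff -> : last (last x p) (rev (belast x p)) = x by [].
  by case: (p) => [//|y q]; rewrite /= rev_cons last_rcons.
Qed.

Lemma linked_map (T T' : eqType) (e : rel T) (P S F : pred T)
    (e' : rel T') (P' S' F' : pred T') (f : T -> T') :
  {homo f : x y / e x y >-> e' x y} ->
  subpred P (preim f P') -> subpred S (preim f S') -> subpred F (preim f F') ->
  linked e P S F -> linked e' P' S' F'.
Proof.
move=> fe fP fS fF [x [p [xp Pp Sx Fp]]]; exists (f x), (map f p); split.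
- exact: homo_path xp.
- by rewrite -map_cons all_map; apply: sub_all Pp.
- exact: fS.
- by rewrite last_map; exact: fF.
Qed.

(** A walk of least length among the repetition-free ones that join [S] to [F]:
    dropping the part before a later visit to [S], or the part after an earlier
    visit to [F], would give a shorter one. *)
Lemma linked_shortest (T : eqType) (x0 : T) (e : rel T) (P S F : pred T) :
  linked e P S F ->
  exists L, [/\ (0 < size L)%N, uniq L, sorted e L & all P L] /\
    [/\ S (nth x0 L 0), F (nth x0 L (size L).-1),
     forall i, (0 < i < size L)%N -> ~~ S (nth x0 L i) &
     forall i, (i < (size L).-1)%N -> ~~ F (nth x0 L i)].
Proof.
move=> [x [p [xp Pp Sx Fp]]].
pose joins L := [&& (0 < size L)%N, uniq L, sorted e L, all P L,
  S (nth x0 L 0) & F (nth x0 L (size L).-1)].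
have [N exN minN] : exists2 N, exists2 L, size L = N & joins L &
    forall L, joins L -> (N <= size L)%N.
  have ex : exists N, `[< exists2 L, size L = N & joins L >].
    move: xp Fp; case/shortenP => p' xp' up' sub Fp'.
    exists (size (x :: p')); apply/asboolP; exists (x :: p') => //.
    apply/and5P; split=> //; last by rewrite /= Sx nth_last.
    by move: Pp => /= /andP[-> /allP Pp]; apply/allP => y /sub; exact: Pp.
  exists (ex_minn ex); first by case: ex_minnP => N /asboolP.
  move=> L jL; case: ex_minnP => N _; apply; apply/asboolP.
  by exists L.
case: exN => L sL /and5P[L0 uL eL PL /andP[SL FL]].
exists L; split=> //; split=> // i.
  move=> /andP[i0 iL]; apply/negP => Si.
  have sD : (0 < size (drop i L))%N by rewrite size_drop subn_gt0.
  suff /minN : joins (drop i L).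
    by rewrite size_drop -sL leqNgt -subn_gt0 subKn ?i0 // ltnW.
  apply/and5P; split; rewrite ?drop_uniq ?drop_sorted //.
  - by move: PL; rewrite -{1}(cat_take_drop i L) all_cat => /andP[].
  - rewrite !nth_drop addn0 Si size_drop -subn1 addnBA ?subn_gt0 //.
    by rewrite subnKC ?subn1 // ltnW.
move=> iL; apply/negP => Fi.
have iS : (i.+1 < size L)%N by rewrite -ltn_predRL.
have sT : size (take i.+1 L) = i.+1 by rewrite size_takel // ltnW.
suff /minN : joins (take i.+1 L) by rewrite sT -sL leqNgt iS.
apply/and5P; split; rewrite ?sT ?take_uniq ?take_sorted //.
- by move: PL; rewrite -{1}(cat_take_drop i.+1 L) all_cat => /andP[].
- by rewrite !nth_take // SL.
Qed.

(** * A plus walk and a star walk across each other meet *)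

(** The ray cut by the step is the half line going left from the upper edge of
    [c]; the abscissa is tested at the end of the step that lies in the row
    of [c]. *)
Definition step_cut (c a b : site) : bool :=
  [&& a.2 == c.2, b.2 == c.2 + 1 & a.1 < c.1]
  (+) [&& b.2 == c.2, a.2 == c.2 + 1 & b.1 < c.1].

Fixpoint walk_cut (c a : site) (q : seq site) : bool :=
  if q is b :: q' then step_cut c a b (+) walk_cut c b q' else false.

Lemma addb_eq_false (a b : bool) : a (+) b = false -> a = b.
Proof. by case: a; case: b. Qed.

(** If moving the base point from [c] to [c'] changes the contribution of each
    step by a coboundary, the whole change only depends on the two ends of the
    walk. *)
Lemma walk_cut_telescope (c c' : site) (J : pred site) a q :
  path star_adj a q ->
  (forall b b', b \in a :: q -> b' \in a :: q -> star_adj b b' ->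
    step_cut c b b' (+) step_cut c' b b' = J b (+) J b') ->
  walk_cut c a q (+) walk_cut c' a q = J a (+) J (last a q).
Proof.
elim: q a => [|b q IH] a /=; first by rewrite addbb.
move=> /andP[ab bq] loc.
have := loc a b; rewrite !inE !eqxx ?orbT => /(_ isT isT ab) e1.
have {}IH := IH b bq; rewrite addbACA e1 IH ?addbA ?addbK // => x x' hx hx'.
by apply: loc; rewrite in_cons ?hx ?hx' orbT.
Qed.

(** Raising the base point from row [y] to row [y + 1] trades the steps that
    leave the half row on the left of [(x, y + 1)] downwards for those that leave
    it upwards.  A step inside row [y + 1] cannot leave the half row, as it would
    have to go through [(x, y + 1)]; and a star step that starts on the left of
    [x] in one of the two rows cannot end strictly to the right of [x] in the
    other. *)
Lemma step_cut_vertical x y (b b' : site) :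
  star_adj b b' -> b != (x, y) -> b' != (x, y) ->
  b != (x, y + 1) -> b' != (x, y + 1) ->
  step_cut (x, y) b b' (+) step_cut (x, y + 1) b b'
  = ((b.2 == y + 1) && (b.1 < x)) (+) ((b'.2 == y + 1) && (b'.1 < x)).
Proof.
case: b b' => [a1 a2] [b1 b2]; rewrite /star_adj /step_cut /= !xpair_eqE => h.
have [d1 d2] : (`|a1 - b1| <= 1) /\ (`|a2 - b2| <= 1) by lia.
move=> {h}.
have [ha|ha] := eqVneq a2 (y + 1); have [hb|hb] := eqVneq b2 (y + 1);
  [| have [hb'|hb'] := eqVneq b2 y | have [ha'|ha'] := eqVneq a2 y | ];
  case: (ltP a1 x) => hax; case: (ltP b1 x) => hbx;
  rewrite ?andbT ?andbF ?andTb ?andFb; try lia.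
Qed.

Lemma step_cut_horizontal x y (b b' : site) :
  b != (x, y) -> b' != (x, y) ->
  step_cut (x, y) b b' (+) step_cut (x + 1, y) b b' = false.
Proof.
case: b b' => [a1 a2] [b1 b2]; rewrite /step_cut /= !xpair_eqE.
case: (eqVneq a2 y) => _; case: (eqVneq b2 y) => _ ; rewrite ?andbT ?andbF ?andTb ?andFb; lia.
Qed.

Lemma walk_cut_left (c a : site) q :
  all (fun k : site => c.1 <= k.1) (a :: q) -> walk_cut c a q = false.
Proof.
elim: q a => [//|b q IH] a /= /and3P[ca cb cq].
by rewrite IH /= ?cb // /step_cut; lia.
Qed.

(** When the whole walk is on the left of [c], its steps that count are exactly
    those that change the truth value of being at most as high as [c]. *)
Lemma walk_cut_right (c a : site) q :
  path star_adj a q -> all (fun k : site => k.1 < c.1) (a :: q) ->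
  walk_cut c a q = (a.2 <= c.2) (+) ((last a q).2 <= c.2).
Proof.
elim: q a => [|b q IH] a /=; first by rewrite addbb.
move=> /andP[ab bq] /and3P[ca cb cq].
rewrite IH //= ?cb // /step_cut ca cb !andbT.
rewrite addbA; congr (_ (+) _); move: ab; rewrite /star_adj => ab.
have {ab} ab : `|a.2 - b.2| <= 1 by lia.
by case: (leP a.2 c.2); case: (leP b.2 c.2); lia.
Qed.

(** The condition on the heights of the ends keeps the boundary terms of
    [step_cut_vertical] equal to zero. *)
Lemma walk_cut_step (c c' a : site) q :
  plus_adj c c' -> path star_adj a q -> c \notin a :: q -> c' \notin a :: q ->
  a.2 < Num.min c.2 c'.2 -> Num.max c.2 c'.2 < (last a q).2 ->
  walk_cut c a q = walk_cut c' a q.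
Proof.
move=> cc' aq.
(* By symmetry, the step goes rightwards or upwards. *)
wlog cE : c c' cc' / c' = (c.1 + 1, c.2) \/ c' = (c.1, c.2 + 1).
  move=> wl cq c'q lo hi.
  have : (c' = (c.1 + 1, c.2) \/ c' = (c.1, c.2 + 1)) \/
         (c = (c'.1 + 1, c'.2) \/ c = (c'.1, c'.2 + 1)).
    move: cc' {wl cq c'q lo hi}; case: c c' => [x y] [x' y'].
    move=> cc'.
    case/or4P: (plus_adj_cases cc')=> /andP[/eqP-> /eqP->];
      by [left; left|left; right|right; left|right; right].
  case=> h; first exact: wl.
  by symmetry; apply: wl => //; [rewrite plus_adj_sym|rewrite minC|rewrite maxC].
case: c c' cc' cE => [x y] c' _ /= [->|->] /= cq c'q lo hi.
  apply: addb_eq_false; rewrite (@walk_cut_telescope _ _ pred0) // => b b' hb hb' bb'.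
  by rewrite step_cut_horizontal // (memPn cq).
apply: addb_eq_false; rewrite (@walk_cut_telescope _ _
  [pred b : site | (b.2 == y + 1) && (b.1 < x)]) // => [|b b' hb hb' bb'].
- by rewrite /=; lia.
- by rewrite step_cut_vertical // ?(memPn cq) ?(memPn c'q).
Qed.

(** If the walks were disjoint, the parity [walk_cut] of [q] would be constant
    along [p], whereas it is 0 at the first square of [p] and 1 at the last. *)
Theorem crossing_walks_meet (c a : site) p q :
  path plus_adj c p -> path star_adj a q ->
  all (fun k : site => (a.2 < k.2) && (k.2 < (last a q).2)) (c :: p) ->
  all (fun k : site => (c.1 <= k.1) && (k.1 < (last c p).1)) (a :: q) ->
  exists2 k, k \in c :: p & k \in a :: q.
Proof.
move=> cp aq vert hor.
have [/hasP[k kq kp]|/hasPn disj] := boolP (has (mem (c :: p)) (a :: q)).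
  by exists k.
have {}disj k : k \in c :: p -> k \notin a :: q.
  by move=> kp; apply/negP => /disj /negP.
have : walk_cut c a q = walk_cut (last c p) a q.
  elim: p c cp vert disj {hor} => [//|c' p IH] c /= /andP[cc' cp].
  case/and3P=> vc vc' vp disj; rewrite -IH //= ?vc' //; last first.
    by move=> k kp; apply: disj; rewrite inE kp orbT.
  apply: walk_cut_step => //; try (apply: disj; rewrite !inE eqxx ?orbT //).
  - lia.
  - lia.
rewrite walk_cut_left; last by apply: sub_all hor => k /andP[].
rewrite walk_cut_right //; last by apply: sub_all hor => k /andP[].
by have /andP[lo hi] := allP vert _ (mem_last c p); rewrite (ltW lo) leNgt hi.
Qed.

(** * The interface of a region reaches the top *)

Lemma addb_telescope (f : nat -> bool) n :
  \big[addb/false]_(i < n) (f i (+) f i.+1) = f 0%N (+) f n.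
Proof.
elim: n => [|n IH]; first by rewrite big_ord0 addbb.
by rewrite big_ord_recr /= IH addbA addbK.
Qed.

(** For [B] disjoint from [A]: the common edge of [k] and [l] separates a square
    of [A] from a square of [B]. *)
Definition gate (A B : pred site) (k l : site) : bool :=
  (A k (+) A l) && (B k || B l).

(** This is what makes [B] keep or drop together the edges of the interface of
    [A] that share an end.  It is only asked in rows [0], ..., [n - 1]: when [A]
    contains a half plane, it also borders squares above and below these rows,
    which need not be related to [B]. *)
Definition interface_local (A B : pred site) (n : nat) : Prop :=
  forall k k' l l', A k -> ~~ A k' -> plus_adj k k' -> 0 <= k'.2 < n%:Z ->
    A l -> ~~ A l' -> plus_adj l l' -> 0 <= l'.2 < n%:Z ->
    star_adj k' l' -> B k' -> B l'.

(** Of the four edges at a lattice point, an even number separates [A] from its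
    complement.  The squares around the point that lie outside [A] and border one
    of these edges are star adjacent to each other, so [B] keeps all of these
    edges or none. *)
Lemma gate_vertex (A B : pred site) n x y :
  (forall k, B k -> ~~ A k) -> interface_local A B n -> 0 <= y -> y + 1 < n%:Z ->
  gate A B (x, y) (x + 1, y) (+) gate A B (x, y + 1) (x + 1, y + 1)
  = gate A B (x, y) (x, y + 1) (+) gate A B (x + 1, y) (x + 1, y + 1).
Proof.
move=> BA loc y0 yn.
set a := (x, y); set b := (x + 1, y); set c := (x, y + 1); set d := (x + 1, y + 1).
have join k k' l l' : A k -> ~~ A k' -> A l -> ~~ A l' ->
    [&& plus_adj k k', plus_adj l l', star_adj k' l',
      0 <= k'.2 < n%:Z & 0 <= l'.2 < n%:Z] -> B k' = B l'.
  move=> Ak Ak' Al Al' /and5P[kk' ll' k'l' k'n l'n].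
  apply/idP/idP; first exact: (loc k k' l l').
  by apply: (loc l l' k k') => //; rewrite star_adj_sym.
have side k k' l l' : [&& plus_adj k k', plus_adj l l', star_adj k' l',
      0 <= k'.2 < n%:Z & 0 <= l'.2 < n%:Z] ->
    [&& A k, ~~ A k', A l & ~~ A l'] ==> (B k' == B l').
  move=> adj; apply/implyP => /and4P[? ? ? ?].
  by apply/eqP; apply: (join k k' l l').
(* For each pair of corners of the 2 x 2 block [a b / c d], the patterns of [A]
   in which both corners border [A] from outside inside the block. *)
have ab : [&& A c, ~~ A a, A d & ~~ A b] ==> (B a == B b).
  by apply: side; rewrite /plus_adj /star_adj /=; lia.
have cd : [&& A a, ~~ A c, A b & ~~ A d] ==> (B c == B d).
  by apply: side; rewrite /plus_adj /star_adj /=; lia.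
have ac : [&& A b, ~~ A a, A d & ~~ A c] ==> (B a == B c).
  by apply: side; rewrite /plus_adj /star_adj /=; lia.
have bd : [&& A a, ~~ A b, A c & ~~ A d] ==> (B b == B d).
  by apply: side; rewrite /plus_adj /star_adj /=; lia.
have bca : [&& A a, ~~ A b, A a & ~~ A c] ==> (B b == B c).
  by apply: side; rewrite /plus_adj /star_adj /=; lia.
have bcd : [&& A d, ~~ A b, A d & ~~ A c] ==> (B b == B c).
  by apply: side; rewrite /plus_adj /star_adj /=; lia.
have adb : [&& A b, ~~ A a, A b & ~~ A d] ==> (B a == B d).
  by apply: side; rewrite /plus_adj /star_adj /=; lia.
have adc : [&& A c, ~~ A a, A c & ~~ A d] ==> (B a == B d).
  by apply: side; rewrite /plus_adj /star_adj /=; lia.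
have BAb k : B k ==> ~~ A k by apply/implyP; exact: BA.
move: (BAb a) (BAb b) (BAb c) (BAb d) ab cd ac bd bca bcd adb adc; rewrite /gate.
by case: (A a); case: (A b); case: (A c); case: (A d);
  case: (B a); case: (B b); case: (B c); case: (B d).
Qed.

(** The number of gates between horizontal neighbours has the same parity in all
    rows.  It is odd in row [0], where every change of [A] between columns [-1]
    and [m] is a gate, so row [n - 1] has a gate, hence a square of [B]. *)
Theorem interface_reaches_top (A B : pred site) (m n : nat) :
  (0 < n)%N -> (forall k, B k -> ~~ A k) -> interface_local A B n ->
  (forall y, A (-1, y)) -> (forall y, ~~ A (m%:Z, y)) ->
  (forall k l, A k -> ~~ A l -> plus_adj k l -> k.2 = 0 -> l.2 = 0 -> B l) ->
  exists k, B k && (k.2 == n%:Z - 1).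
Proof.
move=> n0 BA loc AL AR bot.
pose col (i : nat) : int := i%:Z - 1.
pose row (y : int) :=
  \big[addb/false]_(i < m.+1) gate A B (col i, y) (col i.+1, y).
have colS i : col i.+1 = col i + 1 by rewrite /col; lia.
have col0 : col 0%N = -1 by [].
have colm : col m.+1 = m%:Z by rewrite /col; lia.
have row0 : row 0.
  rewrite /row (eq_bigr (fun i : 'I__ => A (col i, 0) (+) A (col i.+1, 0))).
    by rewrite (addb_telescope (fun i => A (col i, 0))) col0 colm AL (negPf (AR _)).
  move=> i _; rewrite /gate.
  have kl : plus_adj (col i, 0) (col i.+1, 0) by rewrite /plus_adj colS /=; lia.
  have lk : plus_adj (col i.+1, 0) (col i, 0) by rewrite plus_adj_sym.
  case Ak: (A (col i, 0)); case Al: (A (col i.+1, 0)) => //=.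
  - by rewrite (bot _ _ Ak (negbT Al) kl) ?orbT.
  - by rewrite (bot _ _ Al (negbT Ak) lk).
have rowS (j : nat) : (j.+1 < n)%N -> row j%:Z = row j.+1%:Z.
  move=> jn; have jS : j.+1%:Z = j%:Z + 1 by lia.
  apply: addb_eq_false; rewrite jS -big_split /=.
  rewrite (eq_bigr (fun i : 'I__ => gate A B (col i, j%:Z) (col i, j%:Z + 1) (+)
     gate A B (col i.+1, j%:Z) (col i.+1, j%:Z + 1))); last first.
    by move=> i _; rewrite colS (gate_vertex _ BA loc) //; lia.
  rewrite (addb_telescope (fun i => gate A B (col i, j%:Z) (col i, j%:Z + 1))).
  by rewrite col0 colm /gate !AL !(negPf (AR _)).
have rowj (j : nat) : (j < n)%N -> row j%:Z.
  by elim: j => [//|j IH] jn; rewrite -rowS // IH // ltnW.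
have := rowj n.-1; rewrite prednK // leqnn => /(_ isT) rown.
have [i gi] : exists i : 'I_m.+1, gate A B (col i, n.-1%:Z) (col i.+1, n.-1%:Z).
  apply/existsP; apply: contraLR rown => /existsPn none.
  by rewrite /row big1 // => i _; apply/negbTE/none.
by case/andP: gi => _ /orP[]; [exists (col i, n.-1%:Z)|exists (col i.+1, n.-1%:Z)];
  apply/andP; split=> //=; lia.
Qed.

(** * Exactly one of the two walks exists *)

Theorem plus_star_dichotomy (m n : nat) (o : pred site) :
  (0 < m)%N -> (0 < n)%N ->
  let LR := linked plus_adj (predI (in_rect m n) o)
    (fun k => k.1 == 0) (fun k => k.1 == m%:Z - 1) in
  let TD := linked star_adj (predI (in_rect m n) (predC o))
    (fun k => k.2 == n%:Z - 1) (fun k => k.2 == 0) in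
  (LR \/ TD) /\ ~ (LR /\ TD).
Proof.
move=> m0 n0 LR TD; split; last first.
  case=> -[c [p [cp Pp c0 pm]]].
  case/(linked_sym star_adj_sym) => -[ax ay] [q [aq Pq a0 qn]].
  set z := last c p in pm.
  have zP : in_rect m n z && o z by exact: (allP Pp _ (mem_last _ _)).
  set w := last (ax, ay) q in qn.
  have wP : in_rect m n w && ~~ o w by exact: (allP Pq _ (mem_last _ _)).
  have aP : in_rect m n (ax, ay) && ~~ o (ax, ay) by have /andP[] := Pq.
  rewrite /= in c0 a0 pm qn; rewrite /in_rect /= in zP wP aP.
  (* The strict inequalities of [crossing_walks_meet] require one more square at
     the right end of the plus walk and at both ends of the star walk; none of
     the three can be a common square of the prolonged walks. *)
  pose z' : site := (m%:Z, z.2); pose w' : site := (w.1, n%:Z).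
  have [||||k] := @crossing_walks_meet c (ax, -1) (rcons p z') (rcons ((ax, ay) :: q) w').
  - by rewrite rcons_path cp -/z /plus_adj /=; lia.
  - rewrite rcons_cons /= rcons_path aq -/w /star_adj /=; lia.
  - rewrite last_rcons -rcons_cons all_rcons; apply/andP; split; first by rewrite /=; lia.
    by apply: sub_all Pp => k; rewrite /= /in_rect; lia.
  - rewrite last_rcons /= all_rcons; apply/and4P; split; try by rewrite /=; lia.
    by move: Pq => /= /andP[_]; apply: sub_all => k; rewrite /= /in_rect; lia.
  rewrite -rcons_cons mem_rcons inE => kp.
  rewrite inE mem_rcons inE => kq.
  have kx : k.1 < m%:Z.
    case/or3P: kq => [/eqP->|/eqP->|/(allP Pq)/andP[/andP[/andP[_ //] _] _]].
      by case/andP: aP => /andP[/andP[]].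
    by case/andP: wP => /andP[/andP[]].
  have ky : 0 <= k.2 < n%:Z.
    case/orP: kp => [/eqP->|/(allP Pp)/andP[/andP[_ //] _]].
    by case/andP: zP => /andP[].
  case/orP: kp => [/eqP kz|/(allP Pp)/andP[_ ok]].
    by move: kx; rewrite kz ltxx.
  case/or3P: kq => [/eqP kw|/eqP kw|/(allP Pq)/andP[_ /negP]//].
    by move: ky; rewrite kw.
  by move: ky; rewrite kw /= ltxx ?andbF.
have [|noLR] := pselect LR; [by left | right].
(* The half plane [k.1 < 0] makes the left edge part of the interface of [A]
   where it borders vacant squares. *)
pose A (k : site) := (k.1 < 0) || `[< linked plus_adj (predI (in_rect m n) o)
  (fun k => k.1 == 0) (pred1 k) >].
pose B (k : site) := `[< linked star_adj (predI (in_rect m n) (predC o))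
  (fun k => k.2 == 0) (pred1 k) >].
have vacant k l : A k -> ~~ A l -> plus_adj k l -> 0 <= l.2 < n%:Z ->
    in_rect m n l && ~~ o l.
  rewrite /A /plus_adj => Ak /norP[l0 /asboolPn Al] kl ln.
  have lR : in_rect m n l.
    rewrite /in_rect ln andbT.
    case/orP: Ak => [k0|/asboolP Ak]; first by lia.
    have /andP[] := linked_inside Ak; rewrite /in_rect => kR _.
    suff : k.1 != m%:Z - 1 by lia.
    by apply/negP => km; apply: noLR; exact: linked_end Ak km.
  rewrite lR /=; apply/negP => ol; apply: Al.
  have Pl : predI (in_rect m n) o l by rewrite /= lR ol.
  case/orP: Ak => [k0|/asboolP Ak]; last exact: linked_step Ak kl Pl.
  by apply: linked_refl => //=; lia.
have [||||||k /andP[/asboolP Bk kn]] := @interface_reaches_top A B m n.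
- exact: n0.
- move=> k /asboolP /linked_inside /andP[/= kR ok]; apply/norP; split.
    by move: kR; rewrite /in_rect; lia.
  by apply/asboolPn => /linked_inside /andP[_]; rewrite (negPf ok).
- move=> k k' l l' Ak Ak' kk' k'n Al Al' ll' l'n k'l' /asboolP Bk'.
  by apply/asboolP; apply: linked_step Bk' k'l' _; exact: (vacant l l').
- by [].
- move=> y; apply/norP; split; first by rewrite /=; lia.
  by apply/asboolPn => /linked_inside /andP[]; rewrite /in_rect /=; lia.
- move=> k l Ak Al kl k0 l0; apply/asboolP; apply: linked_refl; last exact/eqP.
  by apply: (vacant k l) => //; rewrite l0 lexx; lia.
by apply: linked_sym star_adj_sym _; exact: linked_end Bk kn.
Qed.

(** * Squares of the plane *)

Lemma box_point (R : realType) (a b c d x y : R) :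
  box a b c d (x, y) <-> (a <= x <= b) && (c <= y <= d).
Proof.
rewrite /box /setX /= !in_itv /=; split; first by case=> -> ->.
by case/andP.
Qed.

(** The edges of a square are degenerate boxes, so that this decides when two
    squares have the same edge. *)
Lemma box_inj (R : realType) (a b c d a' b' c' d' : R) : a <= b -> c <= d ->
  box a b c d = box a' b' c' d' -> [/\ a = a', b = b', c = c' & d = d'].
Proof.
move=> ab cd e.
have h x y : (a <= x <= b) && (c <= y <= d) = (a' <= x <= b') && (c' <= y <= d').
  by apply/idP/idP; rewrite -!box_point e.
have := h a c; have := h b d; rewrite !lexx ab cd /=.
move=> /esym/andP[/andP[h1 h2] /andP[h3 h4]] /esym/andP[/andP[h5 h6] /andP[h7 h8]].
have ab' := le_trans h5 h6; have cd' := le_trans h7 h8.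
have := h a' c'; have := h b' d'; rewrite !lexx ab' cd' /=.
move=> /andP[/andP[g1 g2] /andP[g3 g4]] /andP[/andP[g5 g6] /andP[g7 g8]].
by split; apply: le_anti; apply/andP; split.
Qed.

Lemma left_edgeE (R : realType) (a b c d : R) : left_edge a b c d = box a a c d.
Proof. by rewrite /left_edge /box set_itv1. Qed.

Lemma right_edgeE (R : realType) (a b c d : R) : right_edge a b c d = box b b c d.
Proof. by rewrite /right_edge /box set_itv1. Qed.

Lemma bottom_edgeE (R : realType) (a b c d : R) : bottom_edge a b c d = box a b c c.
Proof. by rewrite /bottom_edge /box set_itv1. Qed.

Lemma top_edgeE (R : realType) (a b c d : R) : top_edge a b c d = box a b d d.
Proof. by rewrite /top_edge /box set_itv1. Qed.

Definition edgeE := (left_edgeE, right_edgeE, bottom_edgeE, top_edgeE).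

Lemma lattice_box_inj (R : realType) (a b c d a' b' c' d' : int) : a <= b -> c <= d ->
  box a%:~R b%:~R c%:~R d%:~R = box (a'%:~R : R) b'%:~R c'%:~R d'%:~R ->
  [/\ a = a', b = b', c = c' & d = d'].
Proof.
move=> ab cd /box_inj; rewrite !ler_int => /(_ ab cd)[? ? ? ?].
by split; apply: (@intr_inj R).
Qed.

Lemma plus_adjacentP (R : realType) (k l : site) : plus_adjacent R k l <-> plus_adj k l.
Proof.
case: k l => [x y] [x' y']; rewrite /plus_adjacent /square_edges /box_edges.
rewrite !edgeE /=; split.
  case=> neq [E []] /=.
  have {}neq : (x != x') || (y != y').
    by rewrite -negb_and; apply/negP => /andP[/eqP xx /eqP yy]; apply: neq; rewrite xx yy.
  rewrite /plus_adj /=.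
  by move=> [[[->|->]|->]|->] [[[|]|]|] /lattice_box_inj[||? ? ? ?]; lia.
move=> adj; split; first by case=> ? ?; subst; move: adj; rewrite /plus_adj /=; lia.
case/or4P: (plus_adj_cases adj)=> /andP[/eqP-> /eqP->].
- by exists (box (x + 1)%:~R (x + 1)%:~R y%:~R (y + 1)%:~R); split=> /=; tauto.
- by exists (box x%:~R (x + 1)%:~R (y + 1)%:~R (y + 1)%:~R); split=> /=; tauto.
- by exists (box (x' + 1)%:~R (x' + 1)%:~R y'%:~R (y' + 1)%:~R); split=> /=; tauto.
- by exists (box x'%:~R (x' + 1)%:~R (y' + 1)%:~R (y' + 1)%:~R); split=> /=; tauto.
Qed.

Lemma square_cornersP (R : realType) (k : site) (z : R * R) : square_corners R k z <->
  exists2 c : site, z = (c.1%:~R, c.2%:~R) &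
    (k.1 <= c.1 <= k.1 + 1) && (k.2 <= c.2 <= k.2 + 1).
Proof.
case: k => [x y]; rewrite /square_corners /box_corners /=; split.
  by case=> [[[]|]|] ->; [exists (x, y)|exists (x + 1, y)|exists (x, y + 1)|
    exists (x + 1, y + 1)] => //=; lia.
case=> -[u v] /= -> uv.
have : [|| (u == x) && (v == y), (u == x + 1) && (v == y),
   (u == x) && (v == y + 1) | (u == x + 1) && (v == y + 1)] by lia.
by case/or4P=> /andP[/eqP-> /eqP->]; tauto.
Qed.

Lemma star_adjacentP (R : realType) (k l : site) : star_adjacent R k l <-> star_adj k l.
Proof.
rewrite /star_adjacent /star_adj; split.
  case=> neq [z [/square_cornersP[[u v] -> /= kc]]].
  case/square_cornersP=> -[u' v'] /= [/intr_inj uu' /intr_inj vv'] lc.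
  have {}neq : (k.1 != l.1) || (k.2 != l.2).
    rewrite -negb_and; apply/negP => /andP[/eqP xx /eqP yy]; apply: neq.
    by case: (k) (l) xx yy => [? ?] [? ?] /= -> ->.
  by move: uu' vv' kc lc => -> ->; lia.
move=> adj; split; first by move=> kl; move: adj; rewrite kl; lia.
exists ((Num.max k.1 l.1)%:~R, (Num.max k.2 l.2)%:~R).
split; apply/square_cornersP; exists (Num.max k.1 l.1, Num.max k.2 l.2) => //=; lia.
Qed.

Lemma squareP (R : realType) (k : site) (x y : R) : square R k (x, y) <->
  (k.1%:~R <= x <= (k.1 + 1)%:~R) && (k.2%:~R <= y <= (k.2 + 1)%:~R).
Proof. exact: box_point. Qed.

Lemma square_in_rect (R : realType) m n (k : site) :
  (square R k `<=` box 0 m%:R 0 n%:R)%classic <-> in_rect m n k.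
Proof.
rewrite /in_rect; split.
  move=> sub.
  have := sub (k.1%:~R, k.2%:~R); have := sub ((k.1 + 1)%:~R, (k.2 + 1)%:~R).
  rewrite !squareP !box_point !lexx !ler_int !lerDl ler01 /=.
  move=> /(_ isT)/andP[/andP[_ h1] /andP[_ h2]].
  move=> /(_ isT)/andP[/andP[h3 _] /andP[h4 _]].
  move: h1 h2 h3 h4; rewrite (pmulrn _ m) (pmulrn _ n) !ler_int !ler0z.
  by move=> *; lia.
move=> kR [x y]; rewrite squareP box_point => /andP[/andP[h1 h2] /andP[h3 h4]].
rewrite (le_trans _ h1) ?(le_trans h2) ?(le_trans _ h3) ?(le_trans h4) //.
- by rewrite pmulrn ler_int; lia.
- by rewrite ler0z; lia.
- by rewrite pmulrn ler_int; lia.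
- by rewrite ler0z; lia.
Qed.

(** Two boxes with integer corners that meet have a common lattice point, the
    pair of the larger lower bounds. *)
Lemma square_meets_box (R : realType) (k : site) (a b c d : int) : a <= b -> c <= d ->
  (square R k `&` box a%:~R b%:~R c%:~R d%:~R !=set0)%classic <->
  [&& k.1 <= b, a <= k.1 + 1, k.2 <= d & c <= k.2 + 1].
Proof.
move=> ab cd; split.
  case=> -[x y] [/squareP/andP[/andP[h1 h2] /andP[h3 h4]]].
  case/box_point/andP=> /andP[h5 h6] /andP[h7 h8].
  by rewrite -!(ler_int R) (le_trans h1) // (le_trans h5) // (le_trans h3) // (le_trans h7).
move=> /and4P[h1 h2 h3 h4].
exists ((Num.max k.1 a)%:~R, (Num.max k.2 c)%:~R).
by split; [apply/squareP|apply/box_point]; rewrite !ler_int; lia.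
Qed.

Lemma square_meets_left (R : realType) m n (k : site) : in_rect m n k ->
  (square R k `&` left_edge 0 m%:R 0 n%:R !=set0)%classic <-> k.1 == 0.
Proof.
rewrite /in_rect => kR; rewrite left_edgeE ?(pmulrn _ m) ?(pmulrn _ n).
rewrite (_ : 0 = 0%:~R) // square_meets_box; lia.
Qed.

Lemma square_meets_right (R : realType) m n (k : site) : in_rect m n k ->
  (square R k `&` right_edge 0 m%:R 0 n%:R !=set0)%classic <-> k.1 == m%:Z - 1.
Proof.
rewrite /in_rect => kR; rewrite right_edgeE ?(pmulrn _ m) ?(pmulrn _ n).
rewrite (_ : 0 = 0%:~R) // square_meets_box; lia.
Qed.

Lemma square_meets_bottom (R : realType) m n (k : site) : in_rect m n k ->
  (square R k `&` bottom_edge 0 m%:R 0 n%:R !=set0)%classic <-> k.2 == 0.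
Proof.
rewrite /in_rect => kR; rewrite bottom_edgeE ?(pmulrn _ m) ?(pmulrn _ n).
rewrite (_ : 0 = 0%:~R) // square_meets_box; lia.
Qed.

Lemma square_meets_top (R : realType) m n (k : site) : in_rect m n k ->
  (square R k `&` top_edge 0 m%:R 0 n%:R !=set0)%classic <-> k.2 == n%:Z - 1.
Proof.
rewrite /in_rect => kR; rewrite top_edgeE ?(pmulrn _ m) ?(pmulrn _ n).
rewrite (_ : 0 = 0%:~R) // square_meets_box; lia.
Qed.

(** * From crossings to walks *)

(** A crossing is a walk from [S] to [F] with extra minimality conditions, which
    a shortest walk satisfies. *)
Lemma crossing_linked (R : realType) (adjacent : site -> site -> Prop)
    (e : rel site) (m n : nat) (start finish : set (R * R)) (S F : pred site)
    (omega : site -> state) (s : state) (P : pred site) :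
  (forall k l, adjacent k l <-> e k l) ->
  (forall k, in_rect m n k -> (square R k `&` start !=set0)%classic <-> S k) ->
  (forall k, in_rect m n k -> (square R k `&` finish !=set0)%classic <-> F k) ->
  (forall k, P k <-> omega k = s) ->
  (exists L, crossing adjacent (box (0 : R) m%:R 0 n%:R) start finish L
    /\ all_in_state omega s L) <->
  linked e (predI (in_rect m n) P) S F.
Proof.
move=> adjE startE finishE stateE; split.
  case=> L [[L0 _ LR Le Ls _ Lf _] Lo].
  have inR k : k \in L -> in_rect m n k by move/LR/square_in_rect.
  case: L L0 LR Le Ls Lf Lo inR => [//|x p] _ _ Le Ls Lf Lo inR.
  exists x, p; split.
  - by apply/(pathP (0, 0)) => i ip; apply/adjE; apply: (Le i).
  - by apply/allP => k kL; rewrite /= inR //=; apply/stateE/Lo.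
  - by apply/startE => //; apply: inR; rewrite mem_head.
  - by rewrite (last_nth (0, 0)); apply/finishE => //; apply: inR; rewrite mem_nth.
case/(linked_shortest (0, 0)) => L [[L0 uL eL /allP PL] [SL FL Sonly Fonly]].
have inR k : k \in L -> in_rect m n k by case/PL/andP.
have inRn i : (i < size L)%N -> in_rect m n (nth (0, 0) L i).
  by move=> iL; apply: inR; exact: mem_nth.
exists L; split; last by move=> k /PL /andP[_ /stateE].
split=> //.
- by move=> k kL; apply/square_in_rect; exact: inR.
- by move=> i iL; apply/adjE; move: i iL; exact/sortedP.
- by apply/startE => //; exact: inRn.
- move=> i iL; rewrite startE; first exact/negP/Sonly.
  by apply: inRn; case/andP: iL.
- by apply/finishE => //; apply: inRn; rewrite prednK.
- move=> i iL; rewrite finishE; first exact/negP/Fonly.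
  by apply: inRn; exact: leq_trans iL (leq_pred _).
Qed.

Definition occupied (omega : site -> state) : pred site :=
  fun k => if omega k is Occupied then true else false.

Lemma occupiedP omega k : occupied omega k <-> omega k = Occupied.
Proof. by rewrite /occupied; case: (omega k). Qed.

Lemma vacantP omega k : predC (occupied omega) k <-> omega k = Vacant.
Proof. by rewrite /= /occupied; case: (omega k). Qed.

Theorem theorem2 (R : realType) (m n : nat) (omega : site -> state)
    (hm : (1 <= m)%N) (hn : (1 <= n)%N) :
  ((LR_plus R m n omega Occupied \/ TD_star R m n omega Vacant) /\
   ~ (LR_plus R m n omega Occupied /\ TD_star R m n omega Vacant)) /\
  ((LR_star R m n omega Occupied \/ TD_plus R m n omega Vacant) /\
   ~ (LR_star R m n omega Occupied /\ TD_plus R m n omega Vacant)).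
Proof.
pose sL : pred site := fun k => k.1 == 0.
pose sR (j : nat) : pred site := fun k => k.1 == j%:Z - 1.
pose sB : pred site := fun k => k.2 == 0.
pose sT (j : nat) : pred site := fun k => k.2 == j%:Z - 1.
pose occ := occupied omega.
have LRE adj (e : rel site) : (forall k l, adj k l <-> e k l) ->
    (exists L, left_right_crossing R adj m n L /\ all_in_state omega Occupied L)
    <-> linked e (predI (in_rect m n) occ) sL (sR m).
  move=> adjE; apply: crossing_linked => //; last exact: occupiedP.
  - exact: square_meets_left.
  - exact: square_meets_right.
have TDE adj (e : rel site) : (forall k l, adj k l <-> e k l) ->
    (exists L, top_down_crossing R adj m n L /\ all_in_state omega Vacant L)
    <-> linked e (predI (in_rect m n) (predC occ)) (sT n) sB.
  move=> adjE; apply: crossing_linked => //; last exact: vacantP.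
  - exact: square_meets_top.
  - exact: square_meets_bottom.
rewrite /LR_plus /LR_star /TD_plus /TD_star.
rewrite !(LRE _ _ (@plus_adjacentP R)) !(LRE _ _ (@star_adjacentP R)).
rewrite !(TDE _ _ (@plus_adjacentP R)) !(TDE _ _ (@star_adjacentP R)).
split; first exact: plus_star_dichotomy.
(* Transposing the rectangle turns a top down walk into a right left one, so the
   walks are also reversed. *)
pose swap (k : site) : site := (k.2, k.1).
pose occ' : pred site := fun k => ~~ occ (swap k).
have starE : linked star_adj (predI (in_rect m n) occ) sL (sR m) <->
    linked star_adj (predI (in_rect n m) (predC occ')) (sT m) sB.
  split=> /(linked_sym star_adj_sym); apply: (linked_map (f := swap)) => //.
  - by move=> k l; rewrite /star_adj /= maxC.
  - by move=> [x y]; rewrite /occ' /swap /= ?negbK in_rect_swap.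
  - by move=> k l; rewrite /star_adj /= maxC.
  - by move=> [x y]; rewrite /occ' /swap /= ?negbK in_rect_swap.
have plusE : linked plus_adj (predI (in_rect m n) (predC occ)) (sT n) sB <->
    linked plus_adj (predI (in_rect n m) occ') sL (sR n).
  split=> /(linked_sym plus_adj_sym); apply: (linked_map (f := swap)) => //.
  - by move=> k l; rewrite /plus_adj /= addrC.
  - by move=> [x y]; rewrite /occ' /swap /= ?negbK in_rect_swap.
  - by move=> k l; rewrite /plus_adj /= addrC.
  - by move=> [x y]; rewrite /occ' /swap /= ?negbK in_rect_swap.
rewrite starE plusE.
have [ex excl] := plus_star_dichotomy occ' hn hm.
by split; [case: ex; [right|left] | case=> ? ?; apply: excl].
Qed.
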